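(* Let $m(d)$ denote the maximum number of vertices of the projection polytope ${\rm conv}(WS)={\rm conv}\{Wx : x\in S\}$ over all $n$, all matroids $S\subset\{0,1\}^n$ and all $\{0,1\}$-valued $d\times n$ matrices $W$. Then $$d2^d\ \le\ m(d)\ \le\ 2\sum_{k=0}^{d-1}\binom{\tfrac12(3^d-3)}{k}\ =\ O\left(3^{d(d-1)}\right).$$ For $d\le 2$ the lower and upper bounds coincide, and $m(1)=2$ and $m(2)=8$.
   Context: A set $S\subset\{0,1\}^n$ is called a matroid if it is the set of indicator vectors of the bases of a matroid on the ground set $\{1,\dots,n\}$. *)

(* Defs.v *)
From mathcomp Require Import all_boot all_order all_algebra.
From mathcomp Require Import all_classical all_reals all_analysis.

Set Implicit Arguments.
Unset Strict Implicit.
Unset Printing Implicit Defensive.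

Import Order.TTheory GRing.Theory Num.Theory.
Import numFieldNormedType.Exports.

Local Open Scope classical_set_scope.
Local Open Scope ring_scope.

Definition is_matroid (T : finType) (I : {set {set T}}) : Prop :=
  [/\ finset.set0 \in I,
      forall A B : {set T}, B \in I -> A \subset B -> A \in I
    & forall A B : {set T}, A \in I -> B \in I -> (#|A| < #|B|)%N ->
        exists2 x, x \in B :\: A & x |: A \in I].

Definition is_basis (T : finType) (I : {set {set T}}) (B : {set T}) : Prop :=
  maxset (fun X => X \in I) B.

Definition indicator (R : realType) (n : nat) (B : {set 'I_n}) : 'cV[R]_n :=
  \col_i (i \in B)%:R.

Definition matroid_set (R : realType) (n : nat) (S : set 'cV[R]_n) : Prop :=
  exists2 I : {set {set 'I_n}}, is_matroid I &
    S = [set indicator R B | B in is_basis I].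

Definition zero_one_mx (R : realType) (d n : nat) (W : 'M[R]_(d, n)) : Prop :=
  forall i j, W i j = 0 \/ W i j = 1.

Definition convex_hull (R : realType) (V : lmodType R) (A : set V) : set V :=
  smallest (@convex_set R V) A.

(* Faces are cut out by valid linear inequalities [c *m x <= b]; the choice
   [c = 0], [b = 0] makes the whole polytope a face of itself. *)
Definition is_face (R : realType) (d : nat) (P F : set 'cV[R]_d) : Prop :=
  exists (c : 'rV[R]_d) (b : R),
    (forall x, P x -> (c *m x) 0 0 <= b) /\
    F = P `&` [set x | (c *m x) 0 0 = b].

(* Vertices are the 0-dimensional faces. *)
Definition vertices (R : realType) (d : nat) (P : set 'cV[R]_d) : set 'cV[R]_d :=
  [set v | is_face P [set v]].

Definition projection_polytope (R : realType) (d n : nat) (W : 'M[R]_(d, n))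
    (S : set 'cV[R]_n) : set 'cV[R]_d :=
  convex_hull [set W *m x | x in S].

Definition is_max_vertex_number (R : realType) (d k : nat) : Prop :=
  (exists (n : nat) (S : set 'cV[R]_n) (W : 'M[R]_(d, n)),
     [/\ matroid_set S, zero_one_mx W
       & (vertices (projection_polytope W S) #= `I_k)%card]) /\
  (forall (n : nat) (S : set 'cV[R]_n) (W : 'M[R]_(d, n)),
     matroid_set S -> zero_one_mx W ->
     (vertices (projection_polytope W S) #<= `I_k)%card).

(* For [1 <= d] the number [3 ^ d - 3] is nonnegative and even, so that the
   truncated subtraction and the integer division are exact. *)
Definition vertex_upper_bound (d : nat) : nat :=
  (2 * \sum_(0 <= k < d) 'C((3 ^ d - 3) %/ 2, k))%N.

(* Main.v *)
(** Upper bound.  A vertex [W x_B] is the unique maximiser of some linear form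
    [c], which may be perturbed off all hyperplanes with normals in
    [{-1,0,1}^d].  The signs of [c] on these normals, [(3^d - 1)/2] up to sign, fix the
    order of the values of [c] on the columns of [W], hence, by the greedy
    property of matroids, how many times each column is used by an optimal
    basis.  So there are at most as many vertices as regions of a central
    arrangement of [(3^d - 1)/2] hyperplanes, which deletion-restriction bounds.

    Lower bound.  Take every vector of [{0,1}^d] twice as a column of [W], and the
    uniform matroid of rank 3.  For [u] in the cube and [u'] adjacent to [u], the
    point [2u + u'] is a vertex, and these [d 2^d] points are distinct. *)
Require Import Defs.
From mathcomp Require Import all_boot all_order all_algebra.
From mathcomp Require Import all_classical all_reals all_analysis.
From mathcomp Require Import ring lra zify.

Set Implicit Arguments.
Unset Strict Implicit.
Unset Printing Implicit Defensive.

Import Order.TTheory GRing.Theory Num.Theory.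
Import numFieldNormedType.Exports.
Local Open Scope classical_set_scope.
Local Open Scope ring_scope.

(** * Linear forms as row vectors *)

Definition dot (R : pzRingType) (d : nat) (c : 'rV[R]_d) (x : 'cV[R]_d) : R :=
  (c *m x) 0 0.

Lemma dotDl (R : pzRingType) (d : nat) (c1 c2 : 'rV[R]_d) x :
  dot (c1 + c2) x = dot c1 x + dot c2 x.
Proof. by rewrite /dot mulmxDl mxE. Qed.

Lemma dotZl (R : pzRingType) (d : nat) k (c : 'rV[R]_d) x :
  dot (k *: c) x = k * dot c x.
Proof. by rewrite /dot -scalemxAl mxE. Qed.

Lemma dotDr (R : pzRingType) (d : nat) (c : 'rV[R]_d) x y :
  dot c (x + y) = dot c x + dot c y.
Proof. by rewrite /dot mulmxDr mxE. Qed.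

Lemma dotNr (R : pzRingType) (d : nat) (c : 'rV[R]_d) x :
  dot c (- x) = - dot c x.
Proof. by rewrite /dot mulmxN mxE. Qed.

Lemma dotBr (R : pzRingType) (d : nat) (c : 'rV[R]_d) x y :
  dot c (x - y) = dot c x - dot c y.
Proof. by rewrite dotDr dotNr. Qed.

Lemma dotZr (R : comPzRingType) (d : nat) (c : 'rV[R]_d) k x :
  dot c (k *: x) = k * dot c x.
Proof. by rewrite /dot -scalemxAr mxE. Qed.

Lemma dot0r (R : pzRingType) (d : nat) (c : 'rV[R]_d) : dot c 0 = 0.
Proof. by rewrite /dot mulmx0 mxE. Qed.

Lemma dot_sumr (R : pzRingType) (d : nat) (c : 'rV[R]_d) (T : finType)
    (A : {set T}) (F : T -> 'cV[R]_d) :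
  dot c (\sum_(i in A) F i) = \sum_(i in A) dot c (F i).
Proof. by rewrite /dot mulmx_sumr summxE. Qed.

(** * Counting the sign vectors of a central hyperplane arrangement *)

Definition generic (R : numDomainType) (d : nat) (c : 'rV[R]_d)
    (s : seq 'cV[R]_d) : bool :=
  all (fun a => dot c a != 0) s.

(** Only positivity is recorded: for a generic [c] the entry [false] means a strictly negative
    value. *)
Definition signs (R : numDomainType) (d : nat) (c : 'rV[R]_d)
    (s : seq 'cV[R]_d) : seq bool :=
  [seq 0 < dot c a | a <- s].

(** Split [L] by the first entry. The two sets of tails have total size equal to that of their union
    plus that of their intersection. *)
Lemma size_seq_cons_bool (L : seq (seq bool)) :
  uniq L -> [::] \notin L ->
  (size L <= size (undup (map behead L)) +
     size [seq t <- undup (map behead L)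
          | (true :: t \in L) && (false :: t \in L)])%N.
Proof.
move=> uL nL; set L1 := undup _.
pose LT := [seq t <- L1 | true :: t \in L].
pose LF := [seq t <- L1 | false :: t \in L].
have -> : size [seq t <- L1 | (true :: t \in L) && (false :: t \in L)] =
   count (predI (fun t => true :: t \in L) (fun t => false :: t \in L)) L1.
  by rewrite size_filter.
apply: (@leq_trans (size LT + size LF)).
  rewrite -(size_map (cons true) LT) -(size_map (cons false) LF) -size_cat.
  apply: uniq_leq_size => // -[|x t] tL; first by rewrite tL in nL.
  have tL1 : t \in L1 by rewrite mem_undup; apply/mapP; exists (x :: t).
  rewrite mem_cat; case: x tL => tL; apply/orP; [left|right].
    by apply/mapP; exists t => //; rewrite mem_filter tL.
  by apply/mapP; exists t => //; rewrite mem_filter tL.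
by rewrite !size_filter -count_predUI leq_add2r count_size.
Qed.

(* Two generic vectors with equal signs on [s] and opposite signs on [a] have a
   positive combination on the hyperplane orthogonal to [a], and it has the same
   signs on [s]. *)
Lemma signs_combine (R : realFieldType) (d : nat) (a : 'cV[R]_d)
    (s : seq 'cV[R]_d) (c1 c2 : 'rV[R]_d) :
  0 < dot c1 a -> dot c2 a < 0 -> generic c1 s -> generic c2 s ->
  signs c1 s = signs c2 s ->
  exists2 c, dot c a = 0 & generic c s /\ signs c s = signs c1 s.
Proof.
move=> h1 h2 g1 g2 e12.
(* Both coefficients are positive, and the two contributions cancel at [a]. *)
exists (- dot c2 a *: c1 + dot c1 a *: c2).
  by rewrite dotDl !dotZl; ring.
elim: s g1 g2 e12 => //= h s IH /andP[n1 g1] /andP[n2 g2] [eh es].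
have [-> ->] := IH g1 g2 es.
rewrite dotDl !dotZl andbT.
case: (ltrgt0P (dot c1 h)) n1 eh => // k1 _; case: (ltrgt0P (dot c2 h)) n2 => // k2 _ _.
  have p : 0 < - dot c2 a * dot c1 h + dot c1 a * dot c2 h.
    by rewrite addr_gt0 ?mulr_gt0 ?oppr_gt0.
  by rewrite p (gt_eqF p).
have p : - dot c2 a * dot c1 h + dot c1 a * dot c2 h < 0.
  have q1 : 0 < dot c2 a * dot c1 h by rewrite nmulr_rgt0.
  have q2 : dot c1 a * dot c2 h < 0 by rewrite pmulr_rlt0.
  lra.
by rewrite (lt_eqF p) ltNge (ltW p).
Qed.

(** Pascal's rule, in the shape of the recursion: the first sum pays for deletion, the shorter one
    for restriction to a hyperplane. *)
Lemma sum_binS (n d : nat) :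
  (\sum_(0 <= k < d.+1) 'C(n.+1, k) =
   \sum_(0 <= k < d.+1) 'C(n, k) + \sum_(0 <= k < d) 'C(n, k))%N.
Proof.
rewrite big_nat_recl // [in X in _ = (X + _)%N]big_nat_recl // !bin0 -addnA.
by congr addn; rewrite -big_split /=; apply: eq_bigr => i _; rewrite binS.
Qed.

(* Deletion-restriction: a sign vector of the remaining functionals extends in
   both ways to [a] only if it is realised on the hyperplane of [a], on which
   the remaining functionals form an arrangement of one dimension less. *)
Lemma size_sign_vectors (R : realFieldType) (d : nat) (s : seq 'cV[R]_d)
    (L : seq (seq bool)) :
  (0 < size s)%N -> uniq L ->
  (forall t, t \in L -> exists2 c, generic c s & signs c s = t) ->
  (size L <= 2 * \sum_(0 <= k < d) 'C((size s).-1, k))%N.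
Proof.
move=> s_gt0; have [n] := ubnP (size s); elim: n d s s_gt0 L => // n IH d.
case=> // a s _ L szs uL hL.
have [a0|a0] := eqVneq a 0.
  (* No form is generic for the zero vector, so [L] is empty. *)
  case: L uL hL => // t L _ /(_ t (mem_head _ _))[c] /=.
  by rewrite a0 dot0r eqxx.
case: d => [|d] in a s szs hL a0 *; first by case/eqP: a0; apply: flatmx0.
case: s szs hL => [_ hL|b s szs hL].
  (* A single functional has two possible signs, which the term [k = 0] pays for. *)
  apply: (@leq_trans (size [:: [:: true]; [:: false]])).
    apply: uniq_leq_size => // t /hL[c _ <-] /=.
    by rewrite !inE; case: (0 < _).
  by rewrite /= big_ltn // bin0 mulnDr leq_addr.
have nL : [::] \notin L by apply/negP => /hL[].
apply: leq_trans (size_seq_cons_bool uL nL) _.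
rewrite [(size _).-1]/= sum_binS mulnDr; apply: leq_add.
  apply: (IH d.+1 (b :: s)) => //; first exact: undup_uniq.
  move=> t; rewrite mem_undup => /mapP[t' /hL[c /= /andP[_ gc] <-] ->].
  by exists c.
(* The rows of [K] are a basis of the forms vanishing at [a]. In these coordinates the functional
   [h] restricts to [K *m h]. *)
set K := row_base (kermx a).
have rK : \rank (kermx a) = d.
  rewrite mxrank_ker; suff -> : \rank a = 1%N by rewrite subn1.
  by apply/eqP; rewrite eqn_leq rank_leq_col lt0n mxrank_eq0.
have := IH (\rank (kermx a)) [seq K *m h | h <- b :: s].
rewrite /= size_map => IHK; rewrite -[X in \sum_(0 <= k < X) _]rK.
apply: IHK => //; first exact: filter_uniq (undup_uniq _).
move=> t; rewrite mem_filter => /andP[/andP[/hL[c1 /= /andP[a1 g1] [e1 s1]]]].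
move=> /hL[c2 /= /andP[a2 g2] [e2 s2]] _.
have h2 : dot c2 a < 0 by rewrite lt_neqAle a2 leNgt e2.
have [|c ca [gc sc]] := @signs_combine _ _ a (b :: s) c1 c2 e1 h2 g1 g2.
  by rewrite /= s1 s2.
have /submxP[y ey] : (c <= K)%MS.
  rewrite eq_row_base; apply/sub_kermxP/matrixP => i j.
  by rewrite !ord1 [RHS]mxE.
have dK h : dot y (K *m h) = dot c h by rewrite /dot mulmxA ey.
exists y.
  rewrite /= dK /generic all_map.
  by rewrite (eq_all (a2 := fun h => dot c h != 0)) // => h /=; rewrite dK.
have <- : signs c (b :: s) = t by rewrite sc -s1.
rewrite /signs /= dK -map_comp; congr cons.
by apply: eq_map => h /=; rewrite dK.
Qed.

(** * Perturbing a linear form to a generic one *)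

Lemma dot_tr_gt0 (R : realFieldType) (d : nat) (h : 'cV[R]_d) :
  h != 0 -> 0 < dot h^T h.
Proof.
move=> h0; rewrite /dot mxE lt_neqAle sumr_ge0 ?andbT; last first.
  by move=> i _; rewrite mxE -expr2 sqr_ge0.
apply: contra h0 => /eqP/esym e0.
apply/eqP/matrixP => i j; rewrite ord1 mxE.
have := psumr_eq0P (fun i _ => _) e0 => /(_ _ i isT).
rewrite mxE -expr2 => /(_ _)/eqP; rewrite sqrf_eq0 => H; apply/eqP/H => k.
by rewrite mxE -expr2 sqr_ge0.
Qed.

Lemma small_step (R : realFieldType) (d : nat) (c g : 'rV[R]_d)
    (U : seq 'cV[R]_d) :
  {in U, forall u, dot c u < 0} ->
  exists2 e, 0 < e & {in U, forall u, dot (c + e *: g) u < 0}.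
Proof.
move=> cU.
(* With the absolute value the bound is monotone in [e], so the minimum of two admissible steps is
   admissible. *)
suff [e e0 H] : exists2 e, 0 < e & {in U, forall u, dot c u + e * `|dot g u| < 0}.
  exists e => // u /H; apply: le_lt_trans.
  by rewrite dotDl dotZl lerD2l ler_wpM2l ?ler_norm ?ltW.
elim: U cU => [|u U IH] cU; first by exists 1.
have [v vU|e e0 He] := IH; first by apply: cU; rewrite inE vU orbT.
have cu := cU u (mem_head _ _).
(* The added [1] keeps the denominator positive and makes the final inequality strict. *)
pose f := - dot c u / (`|dot g u| + 1).
have g1 : 0 < `|dot g u| + 1 by rewrite ltr_wpDl.
have f0 : 0 < f by rewrite divr_gt0 ?oppr_gt0.
exists (Num.min e f); first by rewrite lt_min e0.
move=> v; rewrite inE => /predU1P[->|vU].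
  have : f * `|dot g u| < - dot c u.
    have : f * (`|dot g u| + 1) = - dot c u by rewrite divfK ?gt_eqF.
    by rewrite mulrDr mulr1; lra.
  have : Num.min e f * `|dot g u| <= f * `|dot g u|.
    by rewrite ler_wpM2r ?ge_min ?lexx ?orbT.
  lra.
apply: le_lt_trans (He v vU).
by rewrite lerD2l ler_wpM2r ?ge_min ?lexx.
Qed.

(** The vectors of [H] are treated one at a time. As soon as the form is nonzero on [h], its sign
    there joins the strict inequalities of [U], so later perturbations preserve it. *)
Lemma generic_perturbation (R : realFieldType) (d : nat) (c : 'rV[R]_d)
    (H U : seq 'cV[R]_d) :
  0 \notin H -> {in U, forall u, dot c u < 0} ->
  exists2 c', generic c' H & {in U, forall u, dot c' u < 0}.
Proof.
elim: H c U => [|h H IH] c U; first by exists c.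
rewrite inE negb_or eq_sym => /andP[h0 H0] cU.
have [c1 c1h c1U] : exists2 c1, dot c1 h != 0 & {in U, forall u, dot c1 u < 0}.
  have [ch|ch] := eqVneq (dot c h) 0; last by exists c.
  have [e e0 He] := small_step h^T cU; exists (c + e *: h^T) => //.
  by rewrite dotDl dotZl ch add0r gt_eqF // mulr_gt0 // dot_tr_gt0.
pose h' := if dot c1 h < 0 then h else - h.
have c1h' : dot c1 h' < 0.
  rewrite /h'; case: ifPn => // k.
  by rewrite dotNr oppr_lt0 lt_neqAle eq_sym c1h leNgt.
have [u|c2 gc2 c2U] := IH c1 (h' :: U) H0.
  by rewrite inE => /predU1P[->//|/c1U].
exists c2; last by move=> u uU; apply: c2U; rewrite inE uU orbT.
rewrite /= gc2 andbT; have := c2U h' (mem_head _ _).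
by rewrite /h'; case: ifP => _; rewrite ?dotNr ?oppr_lt0 => k;
  rewrite ?(gt_eqF k) ?(lt_eqF k).
Qed.

(** * Vectors with entries in {-1,0,1}, up to sign *)

Fixpoint trits (d : nat) : seq (seq int) :=
  if d is d'.+1 then
    map (cons 1) (trits d') ++ map (cons 0) (trits d') ++ map (cons (-1)) (trits d')
  else [:: [::]].

(* The elements of [trits d] whose first nonzero entry is [1]. *)
Fixpoint half_trits (d : nat) : seq (seq int) :=
  if d is d'.+1 then map (cons 1) (trits d') ++ map (cons 0) (half_trits d')
  else [::].

Lemma size_trits (d : nat) : size (trits d) = (3 ^ d)%N.
Proof. by elim: d => //= d IH; rewrite !size_cat !size_map IH expnS; lia. Qed.

Lemma size_half_trits (d : nat) : ((size (half_trits d)).*2.+1 = 3 ^ d)%N.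
Proof.
elim: d => //= d IH; rewrite size_cat !size_map size_trits expnS -IH; lia.
Qed.

Lemma mem_trits (d : nat) (l : seq int) :
  (l \in trits d) = (size l == d) && all (fun x => x \in [:: 1; 0; -1]) l.
Proof.
have memc (x y : int) t (s : seq (seq int)) :
    (x :: t \in map (cons y) s) = (x == y) && (t \in s).
  apply/mapP/andP => [[t' t's [-> ->]]|[/eqP-> ts]]; first by rewrite eqxx.
  by exists t.
elim: d l => [|d IH] [|x l] //=.
  by rewrite !mem_cat; apply/negbTE/negP => /or3P[] /mapP[].
by rewrite !mem_cat !memc IH eqSS !inE -!andb_orl andbCA.
Qed.

Lemma mem_half_trits (d : nat) (l : seq int) :
  l \in trits d ->
  [\/ l = nseq d 0, l \in half_trits d | map -%R l \in half_trits d].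
Proof.
elim: d l => [|d IH] l /=; first by rewrite inE => /eqP->; apply: Or31.
rewrite !mem_cat => /or3P[] /mapP[t tT ->].
- by apply: Or32; rewrite map_f.
- case: (IH t tT) => H.
  + by rewrite H; apply: Or31.
  + by apply: Or32; rewrite [X in _ || X]map_f ?orbT.
  + by apply: Or33; rewrite /= oppr0 [X in _ || X]map_f ?orbT.
- apply: Or33; rewrite /= opprK map_f //.
  move: tT; rewrite !mem_trits size_map => /andP[-> /=]; rewrite all_map.
  apply: sub_all => x /=; rewrite !inE.
  by case/or3P => /eqP->; rewrite ?opprK ?oppr0 eqxx ?orbT.
Qed.

Lemma half_trits_has1 (d : nat) (l : seq int) :
  l \in half_trits d -> exists2 i, (i < d)%N & nth 0 l i = 1.
Proof.
elim: d l => //= d IH l; rewrite mem_cat => /orP[] /mapP[t tT ->].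
  by exists 0%N.
by have [i] := IH t tT; exists i.+1.
Qed.

Definition intvec (R : pzRingType) (d : nat) (l : seq int) : 'cV[R]_d :=
  \col_(i < d) (nth 0 l i)%:~R.

(* Normals of the hyperplanes separating the possible orders of the values of a
   linear form on [{0,1}^d]. *)
Definition directions (R : pzRingType) (d : nat) : seq 'cV[R]_d :=
  map (@intvec R d) (half_trits d).

(** The region count for [N] hyperplanes has upper index [N - 1]; here [N] is [(3^d - 1)/2], which
    yields the index in [vertex_upper_bound]. *)
Lemma size_directions (R : pzRingType) (d : nat) :
  (0 < d)%N ->
  (0 < size (directions R d))%N /\
  ((size (directions R d)).-1 = (3 ^ d - 3) %/ 2)%N.
Proof.
move=> d0; rewrite size_map -size_half_trits; split; last lia.
by have := size_half_trits d; case: d d0 => // d _; rewrite expnS; lia.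
Qed.

Lemma directions_neq0 (R : numDomainType) (d : nat) : 0 \notin directions R d.
Proof.
apply/negP => /mapP[l /half_trits_has1[i id li] /matrixP/(_ (Ordinal id) 0)].
by rewrite !mxE /= li => /esym/eqP; rewrite oner_eq0.
Qed.

Lemma mem_directions (R : numDomainType) (d : nat) (u : 'cV[R]_d) :
  (forall i, [\/ u i 0 = 1, u i 0 = 0 | u i 0 = -1]) ->
  [\/ u = 0, u \in directions R d | - u \in directions R d].
Proof.
move=> hu.
pose l := [seq (if u i 0 == 1 then 1 else if u i 0 == 0 then 0 else -1 : int)
          | i <- enum 'I_d].
have lT : l \in trits d.
  rewrite mem_trits size_map size_enum_ord eqxx /= all_map.
  by apply/allP => i _ /=; case: ifP => // _; case: ifP.
have ul : u = intvec R d l.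
  apply/matrixP => i j; rewrite ord1 mxE (nth_map i) ?size_enum_ord //.
  rewrite nth_ord_enum; case: (hu i) => ->; rewrite ?eqxx //.
    by rewrite eq_sym oner_eq0.
  by rewrite oppr_eq0 oner_eq0 eq_sym -subr_eq0 opprK -mulr2n pnatr_eq0.
case: (mem_half_trits lT) => H.
- apply: Or31; rewrite ul H; apply/matrixP => i j.
  by rewrite !mxE nth_nseq if_same.
- by apply: Or32; rewrite ul map_f.
- apply: Or33; suff -> : - u = intvec R d (map -%R l) by rewrite map_f.
  rewrite ul; apply/matrixP => i j.
  by rewrite !mxE (nth_map 0) ?mulrNz // size_map size_enum_ord.
Qed.

(** * Matroid bases of maximal weight *)

Lemma matroid_extend (T : finType) (I : {set {set T}}) (A B : {set T}) :
  is_matroid I -> A \in I -> B \in I -> (#|A| <= #|B|)%N ->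
  exists2 X : {set T}, X \in I &
    [/\ A \subset X, X \subset A :|: B & #|X| = #|B|].
Proof.
move=> [_ _ aug] + BI; have [n] := ubnP (#|B| - #|A|).
elim: n A => // n IH A; rewrite ltnS => AB AI.
rewrite leq_eqVlt => /predU1P[cAB|cAB].
  by exists A => //; split => //; apply: finset.subsetUl.
have [x /finset.setDP[xB xA] xI] := aug A B AI BI cAB.
have cx : #|x |: A| = #|A|.+1 by rewrite finset.cardsU1 xA.
have [||X XI [sX Xs cX]] := IH (x |: A) _ xI; rewrite ?cx //.
  by move: AB cAB; lia.
exists X => //; split => //; first exact: fintype.subset_trans (finset.subsetUr _ _) sX.
apply/fintype.subsetP => y /(fintype.subsetP Xs).
by rewrite !inE => /orP[/predU1P[->|->]|->]; rewrite ?xB ?orbT.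
Qed.

Lemma basis_max_card (T : finType) (I : {set {set T}}) (A B : {set T}) :
  is_matroid I -> is_basis I B -> A \in I -> (#|A| <= #|B|)%N.
Proof.
move=> [_ _ aug] /maxsetP[BI Bmax] AI; rewrite leqNgt; apply/negP => cBA.
have [x /finset.setDP[_ xB] /Bmax/(_ (finset.subsetUr _ _)) e] := aug B A BI AI cBA.
by rewrite -e finset.setU11 in xB.
Qed.

Lemma card_basis (T : finType) (I : {set {set T}}) (B X : {set T}) :
  is_matroid I -> is_basis I B -> X \in I -> #|X| = #|B| -> is_basis I X.
Proof.
move=> mI bB XI cX; apply/maxsetP; split => // Y YI XY.
apply/esym/eqP; rewrite finset.eqEcard XY cX.
exact: basis_max_card mI bB YI.
Qed.

Definition weight_optimal (R : numDomainType) (T : finType)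
    (I : {set {set T}}) (w : T -> R) (B : {set T}) : Prop :=
  is_basis I B /\
  forall A, is_basis I A -> \sum_(i in A) w i <= \sum_(i in B) w i.

(* Otherwise augmenting [B :&: E] from [A :&: E] by [j] and completing from [B]
   exchanges some element of [B :\: E] for [j], which increases the weight. *)
Lemma optimal_upper_set (R : realFieldType) (T : finType) (I : {set {set T}})
    (w : T -> R) (A B E : {set T}) :
  is_matroid I -> weight_optimal I w B -> A \in I ->
  (forall i j, i \notin E -> j \in E -> w i < w j) ->
  (#|A :&: E| <= #|B :&: E|)%N.
Proof.
move=> mI [bB opt] AI wE; rewrite leqNgt; apply/negP => lt_BA.
have [BI _] := maxsetP bB; have [_ sub aug] := mI.
have BEI : B :&: E \in I by apply: sub BI (finset.subsetIl _ _).
have AEI : A :&: E \in I by apply: sub AI (finset.subsetIl _ _).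
have [j /finset.setDP[/finset.setIP[jA jE] jBE] jI] := aug _ _ BEI AEI lt_BA.
have jB : j \notin B by apply: contra jBE => jB; rewrite inE jB.
have [|X XI [sX Xs cX]] := matroid_extend mI jI BI; first exact: basis_max_card mI bB jI.
have jX : j \in X by apply: (fintype.subsetP sX); rewrite finset.setU11.
have XjB : X :\ j \subset B.
  apply/fintype.subsetP => x /finset.setD1P[xj /(fintype.subsetP Xs)].
  by rewrite !inE (negbTE xj) /= => /orP[/andP[]|].
have cXj : #|X :\ j|.+1 = #|B| by rewrite -cX [in RHS](cardsD1 j) jX.
have [i iB iX] : exists2 i, i \in B & i \notin X :\ j.
  apply/subsetPn; apply/negP => /subset_leq_card; rewrite -cXj.
  by rewrite ltnn.
have eB : B = i |: (X :\ j).
  apply/esym/eqP; rewrite finset.eqEcard finset.subUset finset.sub1set iB XjB /=.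
  by rewrite finset.cardsU1 iX -cXj.
(* [X] contains all of [B :&: E], so the element of [B] that was given up lies outside [E]. *)
have iE : i \notin E.
  apply: contra iX => iE; rewrite !inE; apply/andP; split.
    by apply: contraNneq jB => <-.
  by apply: (fintype.subsetP sX); rewrite !inE iB iE orbT.
have := opt X (card_basis mI bB XI cX).
rewrite (big_setD1 j jX) /= eB big_setU1 //= lerD2r.
by rewrite leNgt wE.
Qed.

(** Equal multiplicities make the two lists of values permutations of each other. *)
Lemma eq_sum_of_fibers (T : finType) (V : nmodType) (F : T -> V)
    (A B : {set T}) :
  (forall i, #|[set j in A | F j == F i]%SET| =
             #|[set j in B | F j == F i]%SET|) ->
  \sum_(i in A) F i = \sum_(i in B) F i.
Proof.
move=> h; rewrite -!big_enum -!(big_map F xpredT id) /=; apply: perm_big.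
have cnt (C : {set T}) i : count_mem (F i) [seq F j | j <- enum C] =
    #|[set j in C | F j == F i]%SET|.
  rewrite count_map -size_filter -(card_uniqP _); last exact/filter_uniq/enum_uniq.
  by apply: eq_card => j; rewrite !inE mem_filter mem_enum andbC.
by apply/allP => y; rewrite mem_cat => /orP[] /mapP[i _ ->] /=; rewrite !cnt h.
Qed.

(* Both optima meet every upper level set of the common order in equally many
   elements, hence also every class of equal vectors. *)
Lemma optimal_sum_unique (R : realFieldType) (T : finType) (V : nmodType)
    (I : {set {set T}}) (F : T -> V) (w1 w2 : T -> R) (B1 B2 : {set T}) :
  is_matroid I -> weight_optimal I w1 B1 -> weight_optimal I w2 B2 ->
  (forall i j, (w1 i < w1 j) = (w2 i < w2 j)) ->
  (forall i j, (w1 i == w1 j) = (F i == F j)) ->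
  \sum_(i in B1) F i = \sum_(i in B2) F i.
Proof.
move=> mI o1 o2 w12 wF; apply: eq_sum_of_fibers => i.
have [/maxsetP[B1I _] _] := o1; have [/maxsetP[B2I _] _] := o2.
have w12l a b : (w1 a <= w1 b) = (w2 a <= w2 b) by rewrite !leNgt w12.
have eqE (E : {set T}) :
    (forall a b, a \notin E -> b \in E -> w1 a < w1 b) ->
    #|B1 :&: E| = #|B2 :&: E|.
  move=> hE; apply/eqP; rewrite eqn_leq.
  rewrite (optimal_upper_set mI o2 B1I) ?(optimal_upper_set mI o1 B2I) //.
  by move=> a b aE bE; rewrite -w12 hE.
(* Both are upper sets, and [E1 :\: E2] is the class of elements with the same value of [F] as
   [i]. *)
pose E1 := [set j | w1 i <= w1 j]%SET; pose E2 := [set j | w1 i < w1 j]%SET.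
have h1 : #|B1 :&: E1| = #|B2 :&: E1|.
  by apply: eqE => a b; rewrite !inE -ltNge; apply: lt_le_trans.
have h2 : #|B1 :&: E2| = #|B2 :&: E2|.
  by apply: eqE => a b; rewrite !inE -leNgt; apply: le_lt_trans.
have fib (C : {set T}) :
    (#|[set j in C | F j == F i]%SET| + #|C :&: E2| = #|C :&: E1|)%N.
  rewrite -(cardsID E2 (C :&: E1)) addnC; congr addn; apply: eq_card => j.
    by rewrite !inE -andbA; case: ltP => [/ltW->|]; rewrite ?andbF.
  by rewrite !inE -wF eq_le -leNgt; case: (j \in C); rewrite ?andbF.
by apply/eqP; rewrite -(eqn_add2r #|B1 :&: E2|) fib h1 h2 -fib.
Qed.

(** * Vertices of a convex hull *)

Lemma convex_hull_sub (R : realType) (V : lmodType R) (A C : set V) :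
  (forall x y (k : R), 0 < k -> k < 1 -> C x -> C y ->
     C (k *: x + (1 - k) *: y)) ->
  A `<=` C -> convex_hull A `<=` C.
Proof.
move=> cC AC; apply: smallest_sub => //; apply/convex_setW => x y.
rewrite !inE => Cx Cy k k0 k1; apply/mem_set.
exact: (cC _ _ k%:num).
Qed.

(** Vertices are the unique maximisers of linear forms over the generators. In one direction, if [v]
    were not in [A], the hull would lie in an open half-space missing [v]. In the other, an open
    half-space together with the boundary point [v] is still convex. *)
Lemma verticesP (R : realType) (d : nat) (A : set 'cV[R]_d) (v : 'cV[R]_d) :
  vertices (convex_hull A) v <->
  A v /\ exists c, forall x, A x -> x != v -> dot c x < dot c v.
Proof.
have dotconv (c : 'rV[R]_d) k x y :
    dot c (k *: x + (1 - k) *: y) = k * dot c x + (1 - k) * dot c y.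
  by rewrite dotDr !dotZr.
split=> [[c [b [cb ev]]]|[Av [c cv]]].
  have hullA x : A x -> convex_hull A x by exact: sub_gen_smallest.
  have [hv bv] : (convex_hull A `&` [set x | (c *m x) 0 0 = b]) v by rewrite -ev.
  have face x : A x -> x != v -> dot c x < b.
    move=> Ax xv; rewrite lt_neqAle; apply/andP; split; last exact: (cb x (hullA x Ax)).
    apply: contra xv => /eqP xb; apply/eqP.
    by suff: [set v] x by []; rewrite ev; split => //; apply: hullA.
  split; last by exists c => x Ax xv; rewrite [ltRHS]bv; apply: face.
  apply: contrapT => nAv.
  suff /(_ v hv) : convex_hull A `<=` [set x | dot c x < b].
    by rewrite /= [X in X < _]bv ltxx.
  apply: convex_hull_sub => [x y k k0 k1 /= xb yb|x Ax /=].
    by rewrite dotconv; nra.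
  by apply: face => //; apply/eqP => xv; rewrite -xv in nAv.
have hull x : convex_hull A x -> dot c x < dot c v \/ x = v.
  move: x; apply: convex_hull_sub => [x y k k0 k1|x Ax]; last first.
    by have [->|xv] := eqVneq x v; [right | left; apply: cv].
  case=> [xv|->] [yv|->]; rewrite ?dotconv; [left; nra|left; nra|left; nra|right].
  by rewrite -scalerDl addrC subrK scale1r.
exists c, (dot c v); split=> [x /hull[/ltW //|->//]|].
apply/seteqP; split=> [x ->|x [/hull[xv|//] /= xe]].
  by split => //; apply: sub_gen_smallest.
by move: xv; rewrite /dot xe ltxx.
Qed.

Lemma finite_vertices (R : realType) (d : nat) (A : set 'cV[R]_d) :
  finite_set A -> finite_set (vertices (convex_hull A)).
Proof. by apply: sub_finite_set => v /verticesP[]. Qed.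

(** * The upper bound: a vertex is determined by a sign vector *)

Lemma mulmx_indicator (R : realType) (d n : nat) (W : 'M[R]_(d, n))
    (B : {set 'I_n}) :
  W *m indicator R B = \sum_(j in B) col j W.
Proof.
apply/matrixP => i k; rewrite ord1 mxE summxE [RHS]big_mkcond /=.
apply: eq_bigr => j _; rewrite !mxE.
by case: (j \in B); rewrite ?mulr1 ?mulr0.
Qed.

(** Up to sign, [u] is zero or one of the directions. It is applied to differences of two columns of
    a 0/1 matrix, where it compares the weights of the columns. *)
Lemma generic_directions_sign (R : realFieldType) (d : nat)
    (c1 c2 : 'rV[R]_d) (u : 'cV[R]_d) :
  generic c1 (directions R d) -> generic c2 (directions R d) ->
  signs c1 (directions R d) = signs c2 (directions R d) ->
  (forall i, [\/ u i 0 = 1, u i 0 = 0 | u i 0 = -1]) ->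
  (0 < dot c1 u) = (0 < dot c2 u) /\ (dot c1 u == 0) = (u == 0).
Proof.
move=> g1 g2 e12 /mem_directions hu.
have same h : h \in directions R d -> (0 < dot c1 h) = (0 < dot c2 h).
  by move: h; apply/eq_in_map.
case: hu => [->|uH|uH]; first by rewrite !dot0r ltxx !eqxx.
  have := allP g1 _ uH => /= n1; rewrite same // (negbTE n1).
  by split => //; apply/esym/negbTE; apply: contra n1 => /eqP->; rewrite dot0r.
have := allP g1 _ uH; have := allP g2 _ uH; have := same _ uH.
rewrite !dotNr !oppr_gt0 !oppr_eq0 => s n2 n1; split.
  by rewrite !lt_neqAle !(eq_sym 0) n1 n2 /= !leNgt s.
by rewrite (negbTE n1); apply/esym/negbTE; apply: contra n1 => /eqP->; rewrite dot0r.
Qed.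

Lemma same_signs_same_vertex (R : realType) (d n : nat) (W : 'M[R]_(d, n))
    (I : {set {set 'I_n}}) (c1 c2 : 'rV[R]_d) (B1 B2 : {set 'I_n}) :
  is_matroid I -> zero_one_mx W ->
  generic c1 (directions R d) -> generic c2 (directions R d) ->
  signs c1 (directions R d) = signs c2 (directions R d) ->
  weight_optimal I (fun j => dot c1 (col j W)) B1 ->
  weight_optimal I (fun j => dot c2 (col j W)) B2 ->
  W *m indicator R B1 = W *m indicator R B2.
Proof.
move=> mI W01 g1 g2 e12 o1 o2; rewrite !mulmx_indicator.
have key i j := @generic_directions_sign R d c1 c2 (col j W - col i W) g1 g2 e12.
have hu i j k : [\/ (col j W - col i W) k 0 = 1, (col j W - col i W) k 0 = 0
                  | (col j W - col i W) k 0 = -1].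
  rewrite !mxE; case: (W01 k j) => ->; case: (W01 k i) => ->.
  - by apply: Or32; rewrite subr0.
  - by apply: Or33; rewrite sub0r.
  - by apply: Or31; rewrite subr0.
  - by apply: Or32; rewrite subrr.
apply: (optimal_sum_unique mI o1 o2) => i j.
  by have [+ _] := key i j (hu i j); rewrite !dotBr !subr_gt0.
by have [_] := key j i (hu j i); rewrite dotBr !subr_eq0.
Qed.

Lemma vertex_certificate (R : realType) (d n : nat) (W : 'M[R]_(d, n))
    (I : {set {set 'I_n}}) (v : 'cV[R]_d) :
  vertices (projection_polytope W [set indicator R B | B in is_basis I]) v ->
  exists c B, [/\ generic c (directions R d),
    weight_optimal I (fun j => dot c (col j W)) B & v = W *m indicator R B].
Proof.
move=> /verticesP[[_ [B bB <-] <-] [c cmax]].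
(* The form [c] is negative on these finitely many differences. Keeping them negative keeps [B]
   optimal after perturbation. *)
pose U := [seq W *m indicator R A - W *m indicator R B |
            A <- enum {set 'I_n} & `[< is_basis I A >] &&
              (W *m indicator R A != W *m indicator R B)].
have [|c' gc' c'U] := @generic_perturbation R d c (directions R d) U (directions_neq0 R d).
  move=> u /mapP[A]; rewrite mem_filter => /andP[/andP[/asboolP bA AB] _] ->.
  by rewrite dotBr subr_lt0; apply: cmax => //; exists (indicator R A) => //; exists A.
exists c', B; split => //; split => // A bA.
rewrite -!dot_sumr -!mulmx_indicator.
have [->//|AB] := eqVneq (W *m indicator R A) (W *m indicator R B).
apply: ltW; rewrite -subr_lt0 -dotBr; apply: c'U; apply/mapP; exists A => //.
by rewrite mem_filter AB mem_enum !andbT; apply/asboolP.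
Qed.

Lemma finite_projection (R : realType) (d n : nat) (W : 'M[R]_(d, n))
    (S : set 'cV[R]_n) :
  matroid_set S -> finite_set [set W *m x | x in S].
Proof. by move=> [I _ ->]; do 2!apply: finite_image; apply: finite_finset. Qed.

Lemma vertices_le_upper_bound (R : realType) (d n k : nat)
    (S : set 'cV[R]_n) (W : 'M[R]_(d, n)) :
  (0 < d)%N -> matroid_set S -> zero_one_mx W ->
  (vertices (projection_polytope W S) #= `I_k)%card ->
  (k <= vertex_upper_bound d)%N.
Proof.
move=> d0 mS W01 Vk; rewrite -(card_fset_set Vk).
have finV : finite_set (vertices (projection_polytope W S)).
  exact/finite_vertices/finite_projection.
case: mS => I mI eS; rewrite {}eS in Vk finV *.
set V := vertices _ in Vk finV *.
(* A chosen sign vector [f v] certifies each vertex. Equal certificates force equal vertices, so [f]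
   is injective on [V]; elsewhere its value is the default [[::]]. *)
pose cert v t := V v -> exists c B, [/\ generic c (directions R d),
   signs c (directions R d) = t,
   weight_optimal I (fun j => dot c (col j W)) B & v = W *m indicator R B].
have /choice[f fP] : forall v, exists t, cert v t.
  move=> v; have [/vertex_certificate[c [B [gc oB ->]]]|nV] := pselect (V v).
    by exists (signs c (directions R d)) => _; exists c, B.
  by exists [::] => /nV.
have [H0 H1] := size_directions R d0.
have := @size_sign_vectors R d (directions R d) (map f (finmap.enum_fset (fset_set V))) H0.
rewrite size_map H1; apply.
  rewrite map_inj_in_uniq ?finmap.fset_uniq // => x y.
  rewrite !in_fset_set // !inE => /fP[c1 [B1 [g1 s1 o1 e1]]].
  move=> /fP[c2 [B2 [g2 s2 o2 e2]]] exy; rewrite e1 e2.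
  by apply: (same_signs_same_vertex mI W01 g1 g2 _ o1 o2); rewrite s1 s2.
move=> t /mapP[v]; rewrite in_fset_set // inE => /fP[c [B [gc sc _ _]]] ->.
by exists c.
Qed.

(** * The lower bound: the uniform matroid of rank 3 on two copies of the cube *)

Definition uniform_matroid (T : finType) (r : nat) : {set {set T}} :=
  [set A : {set T} | (#|A| <= r)%N]%SET.

Lemma uniform_matroidP (T : finType) (r : nat) : is_matroid (uniform_matroid T r).
Proof.
split=> [|A B|A B]; rewrite !inE ?cards0 //.
  by move=> Br /subset_leq_card /leq_trans; apply.
move=> _ Br AB; have [x xB xA] : exists2 x, x \in B & x \notin A.
  by apply/subsetPn; apply: contraL AB => /subset_leq_card; rewrite -leqNgt.
by exists x; rewrite !inE ?xA // finset.cardsU1 xA (leq_trans AB Br).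
Qed.

Lemma uniform_matroid_basis (T : finType) (r : nat) (A : {set T}) :
  #|A| = r -> is_basis (uniform_matroid T r) A.
Proof.
move=> cA; apply/maxsetP; rewrite inE cA leqnn; split => // B.
by rewrite inE => Br AB; apply/esym/eqP; rewrite finset.eqEcard AB cA.
Qed.

Definition cube_vec (R : realType) (d : nat) (x : {ffun 'I_d -> bool}) : 'cV[R]_d := \col_j (x j)%:R.

Definition flip (d : nat) (x : {ffun 'I_d -> bool}) (i : 'I_d) : {ffun 'I_d -> bool} :=
  [ffun j => (j == i) (+) x j].

(** The lighter coordinate [i] makes [flip x i] the unique second-best cube vertex for [flip_form],
    after [x]. *)
Definition flip_weight (R : realType) (d : nat) (i j : 'I_d) : R :=
  if j == i then 1 else 2.

Definition flip_form (R : realType) (d : nat)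
    (x : {ffun 'I_d -> bool}) (i : 'I_d) : 'rV[R]_d :=
  \row_j (if x j then flip_weight R i j else - flip_weight R i j).

(** This is a weighted Hamming distance from [x], equal to the drop of [flip_form] between [x] and
    [y]. *)
Definition flip_loss (R : realType) (d : nat)
    (x : {ffun 'I_d -> bool}) (i : 'I_d) (y : {ffun 'I_d -> bool}) : R :=
  \sum_j (if y j == x j then 0 else flip_weight R i j).

Lemma dot_flip_form (R : realType) (d : nat)
    (x y : {ffun 'I_d -> bool}) (i : 'I_d) :
  dot (flip_form R x i) (cube_vec R y) =
  dot (flip_form R x i) (cube_vec R x) - flip_loss R x i y.
Proof.
rewrite /dot !mxE -sumrB; apply: eq_bigr => j _; rewrite !mxE.
by case: (x j); case: (y j); rewrite ?mulr1 ?mulr0 ?subr0 ?sub0r ?subrr.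
Qed.

Lemma flip_weight_gt0 (R : realType) (d : nat) (i j : 'I_d) : 0 < flip_weight R i j.
Proof. by rewrite /flip_weight; case: ifP. Qed.

Lemma flip_loss_ge (R : realType) (d : nat)
    (x y : {ffun 'I_d -> bool}) (i j : 'I_d) :
  y j != x j -> flip_weight R i j <= flip_loss R x i y.
Proof.
move=> yxj; rewrite /flip_loss (bigD1 j) //= (negbTE yxj) lerDl sumr_ge0 //.
by move=> k _; case: ifP => // _; apply/ltW/flip_weight_gt0.
Qed.

Lemma flip_loss_ge0 (R : realType) (d : nat)
    (x y : {ffun 'I_d -> bool}) (i : 'I_d) :
  0 <= flip_loss R x i y.
Proof.
by apply: sumr_ge0 => k _; case: ifP => // _; apply/ltW/flip_weight_gt0.
Qed.

Lemma flip_loss_ge1 (R : realType) (d : nat)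
    (x y : {ffun 'I_d -> bool}) (i : 'I_d) :
  y != x -> 1 <= flip_loss R x i y.
Proof.
move=> /eqP yx; have [j yxj] : exists j, y j != x j.
  apply/existsP; apply: contra_notT yx => /existsPn yx.
  by apply/ffunP => j; apply/eqP; rewrite -[_ == _]negbK yx.
by apply: le_trans (flip_loss_ge R i yxj); rewrite /flip_weight; case: ifP; rewrite ?ler1n.
Qed.

Lemma flip_loss_ge2 (R : realType) (d : nat)
    (x y : {ffun 'I_d -> bool}) (i : 'I_d) :
  y != x -> y != flip x i -> 2 <= flip_loss R x i y.
Proof.
move=> yx /eqP yf; have [/existsP[j /andP[ji yxj]]|/existsPn h] :=
  boolP [exists j, (j != i) && (y j != x j)].
  by apply: le_trans (flip_loss_ge R i yxj); rewrite /flip_weight (negbTE ji).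
have hj j : j != i -> y j = x j.
  by move=> ji; have := h j; rewrite ji negbK => /eqP.
have [yxi|yxi] := eqVneq (y i) (x i).
  case/eqP: yx; apply/ffunP => j.
  by have [->//|/hj] := eqVneq j i.
case: yf; apply/ffunP => j; rewrite ffunE.
have [->|ji] := eqVneq j i; last by rewrite hj.
by move: yxi; case: (y i); case: (x i).
Qed.

Lemma flip_loss_flip (R : realType) (d : nat)
    (x : {ffun 'I_d -> bool}) (i : 'I_d) :
  flip_loss R x i (flip x i) = 1.
Proof.
rewrite /flip_loss (bigD1 i) //= big1 ?addr0 => [|j /negbTE ji].
  by rewrite ffunE /flip_weight eqxx; case: (x i).
by rewrite ffunE ji eqxx.
Qed.

(** The boolean distinguishes the two copies of each cube vertex. *)
Definition two_cubes (d : nat) : finType := ({ffun 'I_d -> bool} * bool)%type.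

Definition two_cubes_mx (R : realType) (d : nat) : 'M[R]_(d, #|{: two_cubes d}|) :=
  \matrix_(j, k) ((enum_val k : two_cubes d).1 j)%:R.

Lemma col_two_cubes_mx (R : realType) (d : nat) k :
  col k (two_cubes_mx R d) = cube_vec R (enum_val k : two_cubes d).1.
Proof. by apply/matrixP => i j; rewrite !mxE. Qed.

Definition flip_vertex (R : realType) (d : nat)
    (p : {ffun 'I_d -> bool} * 'I_d) : 'cV[R]_d :=
  cube_vec R p.1 + cube_vec R p.1 + cube_vec R (flip p.1 p.2).

(** Coordinate [i] of the point is [1] or [2] and all others are [0] or [3]. This reveals [i], and
    then each coordinate reveals that of [x]. *)
Lemma flip_vertex_inj (R : realType) (d : nat) : injective (@flip_vertex R d).
Proof.
move=> [x i] [y k] e.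
have ej j : (x j + x j + flip x i j = y j + y j + flip y k j :> nat)%N.
  move/matrixP/(_ j 0): e; rewrite /flip_vertex !mxE -!natrD /=.
  by move/eqP; rewrite eqr_nat => /eqP.
have ik : i = k.
  apply/eqP; have := ej i; rewrite !ffunE eqxx.
  by case: eqP => // _; case: (x i); case: (y i).
congr pair => //; apply/ffunP => j; have := ej j; rewrite -ik !ffunE.
by case: (j == i); case: (x j); case: (y j).
Qed.

(* Three elements have total loss at least [1], because only two of them carry
   the column [x]; equality forces the third to carry the column [flip x i]. *)
Lemma flip_vertexP (R : realType) (d : nat) (p : {ffun 'I_d -> bool} * 'I_d) :
  vertices (projection_polytope (two_cubes_mx R d)
    [set indicator R B | B in is_basis (uniform_matroid _ 3%N)]) (flip_vertex R p).
Proof.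
case: p => x i; set T := two_cubes d; pose r (t : T) := enum_rank t.
pose B0 := [set r (x, true); r (x, false); r (flip x i, false)]%SET.
have fx : flip x i != x.
  by apply/eqP => /ffunP/(_ i); rewrite ffunE eqxx; case: (x i).
have r12 : r (x, true) != r (x, false) by rewrite (inj_eq enum_rank_inj) xpair_eqE andbF.
have r3 : r (flip x i, false) \notin [set r (x, true); r (x, false)]%SET.
  by rewrite !inE !(inj_eq enum_rank_inj) !xpair_eqE (negbTE fx).
have cB0 : #|B0| = 3%N by rewrite /B0 finset.setUC finset.cardsU1 r3 cards2 r12.
have bB0 := uniform_matroid_basis cB0.
have vB0 : two_cubes_mx R d *m indicator R B0 = flip_vertex R (x, i).
  rewrite mulmx_indicator /B0 finset.setUC big_setU1 //= big_setU1 ?inE //= big_set1.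
  by rewrite !col_two_cubes_mx !enum_rankK /flip_vertex /= addrC.
apply/verticesP; split.
  by exists (indicator R B0) => //; exists B0.
exists (flip_form R x i) => _ [_ [A bA <-] <-] Av.
have cA : #|A| = 3%N.
  apply/eqP; rewrite eqn_leq; have [/[!inE]-> _] := maxsetP bA.
  rewrite -cB0; apply: basis_max_card bA _; first exact: uniform_matroidP.
  by rewrite inE cB0.
pose F (k : 'I_#|{: T}|) := (enum_val k : T).1.
have WA : two_cubes_mx R d *m indicator R A = \sum_(k in A) cube_vec R (F k).
  by rewrite mulmx_indicator; apply: eq_bigr => k _; rewrite col_two_cubes_mx.
set m := dot (flip_form R x i) (cube_vec R x).
(* Measured from [m *+ 3], the claim becomes that the total loss over [A] exceeds [1]. *)
have -> : dot (flip_form R x i) (flip_vertex R (x, i)) = m *+ 3 - 1.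
  by rewrite /flip_vertex !dotDr /= (dot_flip_form R x (flip x i) i) flip_loss_flip -/m; ring.
have -> : dot (flip_form R x i) (two_cubes_mx R d *m indicator R A) =
    m *+ 3 - \sum_(k in A) flip_loss R x i (F k).
  rewrite WA dot_sumr -cA -sumr_const -sumrB.
  by apply: eq_bigr => k _; apply: dot_flip_form.
rewrite ltrD2l ltrN2 ltNge; apply: contra Av => loss1; apply/eqP; rewrite WA.
have [k kA kx] : exists2 k, k \in A & F k != x.
  have : ~~ (A \subset [set r (x, true); r (x, false)]%SET).
    by apply: contraL isT => /subset_leq_card; rewrite cA cards2 r12.
  case/subsetPn => k kA; rewrite !inE negb_or => /andP[k1 k2]; exists k => //.
  apply: contra k1 => /eqP kx; move: k2; rewrite -[k]enum_valK.
  move: kx; rewrite /F; case: (enum_val k) => y [] /= -> //.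
  by rewrite eqxx.
move: loss1; rewrite !(big_setD1 k kA) /= => loss1.
(* A second element not carrying [x] would raise the total loss to at least [2]. *)
have rest j : j \in A :\ k -> F j = x.
  move=> jA; apply: contraTeq loss1 => jx; rewrite -ltNge.
  rewrite (big_setD1 j jA) /=.
  have h1 := flip_loss_ge1 R i kx; have h2 := flip_loss_ge1 R i jx.
  have h3 : 0 <= \sum_(l in A :\ k :\ j) flip_loss R x i (F l).
    by apply: sumr_ge0 => l _; apply: flip_loss_ge0.
  lra.
have Fk : F k = flip x i.
  apply: contraTeq loss1 => kf; rewrite -ltNge.
  have h1 := flip_loss_ge2 R kx kf.
  have h3 : 0 <= \sum_(l in A :\ k) flip_loss R x i (F l).
    by apply: sumr_ge0 => l _; apply: flip_loss_ge0.
  lra.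
have cAk : #|A :\ k| = 2%N by apply/eqP; rewrite -eqSS -cA [in X in _ == X](cardsD1 k) kA.
rewrite (eq_bigr (fun=> cube_vec R x)) => [|j /rest-> //].
by rewrite sumr_const cAk Fk addrC mulr2n.
Qed.

(** The exact number [k] of vertices stays unknown; the distinct points [flip_vertex] bound it from
    below. *)
Lemma lower_bound_instance (R : realType) (d : nat) :
  exists (n : nat) (S : set 'cV[R]_n) (W : 'M[R]_(d, n)) (k : nat),
    [/\ matroid_set S, zero_one_mx W,
        (vertices (projection_polytope W S) #= `I_k)%card
      & (d * 2 ^ d <= k)%N].
Proof.
set I := uniform_matroid ('I_#|{: two_cubes d}|) 3%N.
pose S := [set indicator R B | B in is_basis I].
have mS : matroid_set S by exists I => //; exact: uniform_matroidP.
have finV := finite_vertices (finite_projection (two_cubes_mx R d) mS).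
have /finite_setP[k Vk] := finV.
exists _, S, (two_cubes_mx R d), k; split => //.
  by move=> i j; rewrite mxE; case: (_ i); [right|left].
rewrite -(card_fset_set Vk).
have <- : size (map (@flip_vertex R d) (enum {: {ffun 'I_d -> bool} * 'I_d})) =
    (d * 2 ^ d)%N.
  by rewrite size_map -cardE card_prod card_ffun card_bool !card_ord mulnC.
apply: uniq_leq_size; first by rewrite map_inj_uniq ?enum_uniq //; exact: flip_vertex_inj.
move=> _ /mapP[p _ ->].
by rewrite in_fset_set // inE; apply: flip_vertexP.
Qed.

(** * Size of the upper bound *)

Lemma sum_pow_le (r n : nat) :
  (1 < r)%N -> (\sum_(0 <= k < n.+1) r ^ k <= 2 * r ^ n)%N.
Proof.
move=> r1; elim: n => [|n IH]; first by rewrite big_nat1.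
rewrite big_nat_recr //= mul2n -addnn leq_add2r (leq_trans IH) //.
by rewrite expnS leq_mul2r r1 orbT.
Qed.

Lemma bin_le_exp (n k : nat) : ('C(n, k) <= n ^ k)%N.
Proof.
have h : (n ^_ k <= n ^ k)%N.
  elim: k n => [|k IH] [|n] //.
  rewrite ffactnS expnS leq_mul2l /=; apply: leq_trans (IH n) _.
  by case: k {IH} => // k; rewrite leq_exp2r.
by apply: leq_trans h; rewrite -bin_ffact leq_pmulr ?fact_gt0.
Qed.

(** Each binomial is at most [(3^d)^k], and a geometric sum is at most twice its last term. With the
    leading factor [2] this gives the constant [4]. *)
Lemma vertex_upper_bound_le (d : nat) :
  (0 < d)%N -> (vertex_upper_bound d <= 4 * 3 ^ (d * (d - 1)))%N.
Proof.
case: d => // d _; rewrite subn1 /= expnM -[4%N]/(2 * 2)%N -mulnA leq_mul2l /=.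
apply: leq_trans (sum_pow_le d _); last first.
  by rewrite -[1%N](expn0 3) ltn_exp2l.
apply: leq_sum => k _; apply: leq_trans (bin_le_exp _ _) _.
apply: (@leq_trans ((3 ^ d.+1) ^ k)) => //.
case: k => // k; rewrite leq_exp2r //.
by apply: leq_trans (leq_div _ _) (leq_subr _ _).
Qed.

Lemma vertex_upper_bound_small (d : nat) :
  (0 < d)%N -> (d <= 2)%N -> (d * 2 ^ d)%N = vertex_upper_bound d.
Proof.
case: d => [|[|[|]]] // _ _; rewrite /vertex_upper_bound.
  by rewrite big_nat1 bin0.
by rewrite big_nat_recr //= big_nat1 bin0 bin1.
Qed.

(** * Existence of the maximum, and the conclusion *)

Lemma exists_max_vertex_number (R : realType) (d : nat) :
  (0 < d)%N ->
  exists m, [/\ is_max_vertex_number R d m, (d * 2 ^ d <= m)%N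
              & (m <= vertex_upper_bound d)%N].
Proof.
move=> d0.
pose attained k := exists (n : nat) (S : set 'cV[R]_n) (W : 'M[R]_(d, n)),
  [/\ matroid_set S, zero_one_mx W
    & (vertices (projection_polytope W S) #= `I_k)%card].
have ub k : `[< attained k >] -> (k <= vertex_upper_bound d)%N.
  move=> /asboolP[n [S [W [mS W01 Vk]]]].
  exact: vertices_le_upper_bound mS W01 Vk.
have [n [S [W [k [mS W01 Vk kd]]]]] := lower_bound_instance R d.
have ak : `[< attained k >] by apply/asboolP; exists n, S, W.
have ex : exists k, `[< attained k >] by exists k.
case: (ex_maxnP ex ub) => m am mmax; exists m; split; last exact: ub.
  split; first exact/asboolP.
  move=> n' S' W' mS' W01'.
  (* The vertex set is finite, so its size [l] is itself an attained value. *)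
  have /finite_setP[l Vl] := finite_vertices (finite_projection W' mS').
  rewrite (card_le_eql Vl) card_le_II; apply: mmax.
  by apply/asboolP; exists n', S', W'.
exact: leq_trans kd (mmax _ ak).
Qed.

Theorem theorem4p6 (R : realType) :
  exists m : nat -> nat,
    [/\ (forall d : nat, (0 < d)%N -> is_max_vertex_number R d (m d)),
        (forall d : nat, (0 < d)%N ->
           (d * 2 ^ d <= m d)%N /\ (m d <= vertex_upper_bound d)%N),
        (fun d : nat => (vertex_upper_bound d)%:R : R^o)
          =O_\oo (fun d : nat => 3 ^+ (d * (d - 1)) : R^o),
        (forall d : nat, (0 < d)%N -> (d <= 2)%N ->
           (d * 2 ^ d)%N = vertex_upper_bound d)
      & m 1%N = 2%N /\ m 2%N = 8%N].
Proof.
have /choice[m mP] : forall d, exists m, (0 < d)%N ->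
    [/\ is_max_vertex_number R d m, (d * 2 ^ d <= m)%N
      & (m <= vertex_upper_bound d)%N].
  (* The value at [d = 0] is an arbitrary default. *)
  move=> [|d]; first by exists 0%N.
  by have [m hm] := exists_max_vertex_number R (ltn0Sn d); exists m.
have small d : (0 < d)%N -> (d <= 2)%N -> m d = (d * 2 ^ d)%N.
  move=> d0 d2; have [_ lo up] := mP d d0.
  by apply/eqP; rewrite eqn_leq lo (vertex_upper_bound_small d0 d2) up.
exists m; split.
- by move=> d /mP[].
- by move=> d /mP[].
- apply/eqO_exP; exists 4 => //; near=> d.
  have d0 : (0 < d)%N by near: d; exact: nbhs_infty_gt.
  rewrite normr_nat ger0_norm ?exprn_ge0 // -natrX -natrM ler_nat.
  exact: vertex_upper_bound_le.
- exact: vertex_upper_bound_small.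
- by rewrite !small.
Unshelve. all: by end_near.
Qed.
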